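(* Let $M$ be an extended metric space with at least two elements. Then there is no isometric embedding $\mathcal{P}'_{\mathrm{cl}}M\to M$.
   Context: For an extended metric space $M$ (distances in $[0,\infty]$), $\mathcal{P}'_{\mathrm{cl}}M$ is the set of nonempty closed subsets of $M$ equipped with the Hausdorff distance $\bar d(S,T)=\max(\sup_{x\in S}\inf_{y\in T}d(x,y),\sup_{y\in T}\inf_{x\in S}d(x,y))$. An isometric embedding is a distance-preserving map. *)

(* Defs.v *)
From HB Require Import structures.
From mathcomp Require Import all_boot all_order all_algebra.
From mathcomp Require Import all_classical all_reals ereal topology.

Set Implicit Arguments.
Unset Strict Implicit.
Unset Printing Implicit Defensive.

Import Order.TTheory GRing.Theory Num.Theory.

Local Open Scope classical_set_scope.
Local Open Scope ring_scope.
Local Open Scope ereal_scope.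

(* The analogue of the library's metricType for distances in [0, +oo]; the
   library's notion has finite distances only. The last field says that the
   ambient topology (hence [closed]) is the one induced by the distance. *)
HB.mixin Record PseudoMetric_isExtMetric (R : realType) M
    & PseudoMetric R M := {
  emdist : M -> M -> \bar R ;
  emdist_ge0 : forall x y, 0 <= emdist x y ;
  emdistxx : forall x, emdist x x = 0 ;
  emdist_positivity : forall x y, emdist x y = 0 -> x = y ;
  emdist_sym : forall x y, emdist x y = emdist y x ;
  emdist_triangle : forall y x z, emdist x z <= emdist x y + emdist y z ;
  ballEemdist : forall x (e : R), ball x e = [set y | emdist x y < e%:E]
}.

#[short(type="extMetricType")]
HB.structure Definition ExtMetric (R : realType) :=
  { M of PseudoMetric R M & PseudoMetric_isExtMetric R M }.

(* No assumption on the topology: it is built from the distance. *)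
HB.factory Record isExtMetric (R : realType) M & Choice M := {
  emdist : M -> M -> \bar R ;
  emdist_ge0 : forall x y, 0 <= emdist x y ;
  emdistxx : forall x, emdist x x = 0 ;
  emdist_positivity : forall x y, emdist x y = 0 -> x = y ;
  emdist_sym : forall x y, emdist x y = emdist y x ;
  emdist_triangle : forall y x z, emdist x z <= emdist x y + emdist y z
}.

HB.builders Context R M & isExtMetric R M.

Let ball (x : M) (e : R) : set M := [set y | emdist x y < e%:E].

Let ent : set_system (M * M) := entourage_ ball.

Let nbhs (x : M) : set_system M := nbhs_ ent x.

Let nbhsE : nbhs = nbhs_ ent. Proof. by []. Qed.

HB.instance Definition _ := hasNbhs.Build M nbhs.

Let ball_center x (e : R) : (0 < e)%R -> ball x e x.
Proof. by move=> e0; rewrite /ball/= emdistxx lte_fin. Qed.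

Let ball_sym x y (e : R) : ball x e y -> ball y e x.
Proof. by rewrite /ball/= emdist_sym. Qed.

Let ball_triangle x y z e1 e2 : ball x e1 y -> ball y e2 z ->
  ball x (e1 + e2)%R z.
Proof.
rewrite /ball/= => xy yz.
by rewrite (le_lt_trans (emdist_triangle y _ _))// EFinD lteD.
Qed.

Let entourageE : ent = entourage_ ball. Proof. by []. Qed.

HB.instance Definition _ := @Nbhs_isPseudoMetric.Build R M
  ent nbhsE ball ball_center ball_sym ball_triangle entourageE.

Let ballEemdist x (e : R) : ball x e = [set y | emdist x y < e%:E].
Proof. by []. Qed.

HB.instance Definition _ := PseudoMetric_isExtMetric.Build R M
  emdist_ge0 emdistxx emdist_positivity emdist_sym emdist_triangle ballEemdist.

HB.end.

Definition isometric_embedding (R : realType) (M N : extMetricType R)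
  (f : M -> N) := forall x y, emdist (f x) (f y) = emdist x y.

Section hausdorff_dist.
Context {R : realType} {M : extMetricType R}.
Implicit Types (S T U : set M) (x y : M).

Definition hausdorff_dist S T : \bar R :=
  maxe (ereal_sup [set ereal_inf [set emdist x y | y in T] | x in S])
       (ereal_sup [set ereal_inf [set emdist x y | x in S] | y in T]).

Let dset x T := ereal_inf [set emdist x y | y in T].
Let excess S T := ereal_sup [set dset x T | x in S].

Let hausdorff_distE S T : hausdorff_dist S T = maxe (excess S T) (excess T S).
Proof.
rewrite /hausdorff_dist; congr (maxe _ (ereal_sup _)).
apply: eq_imagel => y _; congr ereal_inf.
by apply: eq_imagel => x _; rewrite emdist_sym.
Qed.

Let dset_ge0 x T : 0 <= dset x T.
Proof. by apply: le_ereal_inf_tmp => _ [y _ <-]; exact: emdist_ge0. Qed.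

Let excess_ge0 S T : S !=set0 -> 0 <= excess S T.
Proof.
by move=> [x Sx]; apply: (le_trans (dset_ge0 x T)); apply: ereal_sup_ubound; exists x.
Qed.

Let le_dsetD x T (a c : \bar R) : 0 <= c ->
  (forall y, T y -> a <= emdist x y + c) -> a <= dset x T + c.
Proof.
move=> c0 h; case: c c0 h => [r| |] // c0 h; last first.
  by rewrite addey ?leey// -ltNye (lt_le_trans _ (dset_ge0 x T)).
rewrite -leeBlDr//; apply: le_ereal_inf_tmp => _ [y Ty <-].
by rewrite leeBlDr//; exact: h.
Qed.

Let dset_triangle x y U : dset x U <= emdist x y + dset y U.
Proof.
rewrite addeC; apply: le_dsetD; first exact: emdist_ge0.
move=> z Uz; rewrite addeC; apply: (le_trans _ (emdist_triangle y x z)).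
by apply: ereal_inf_lbound; exists z.
Qed.

Let excess_triangle T S U : T !=set0 -> excess S U <= excess S T + excess T U.
Proof.
move=> T0; apply: ge_ereal_sup => _ [x Sx <-].
apply: (@le_trans _ _ (dset x T + excess T U)).
  apply: le_dsetD; first exact: excess_ge0.
  move=> y Ty; apply: (le_trans (dset_triangle x y U)).
  by apply: leeD2l; apply: ereal_sup_ubound; exists y.
by apply: leeD2r; apply: ereal_sup_ubound; exists x.
Qed.

Let excess_le0 S T : closed T -> excess S T <= 0 -> S `<=` T.
Proof.
move=> cT ST0 x Sx; apply: cT => B /nbhs_ballP[e /= e0 xeB].
have : dset x T < e%:E.
  apply: (@le_lt_trans _ _ 0); last by rewrite lte_fin.
  by apply: le_trans ST0; apply: ereal_sup_ubound; exists x.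
move=> /ereal_inf_lt[_ [y Ty <-]] xye; exists y; split => //.
by apply: xeB; rewrite ballEemdist.
Qed.

Lemma hausdorff_dist_ge0 S T : S !=set0 -> 0 <= hausdorff_dist S T.
Proof. by move=> S0; rewrite hausdorff_distE le_max excess_ge0. Qed.

Lemma hausdorff_distxx S : S !=set0 -> hausdorff_dist S S = 0.
Proof.
move=> S0; rewrite hausdorff_distE maxxx; apply/eqP.
rewrite eq_le excess_ge0// andbT; apply: ge_ereal_sup => _ [x Sx <-].
by rewrite -(emdistxx x); apply: ereal_inf_lbound; exists x.
Qed.

Lemma hausdorff_dist_positivity S T : closed S -> closed T ->
  hausdorff_dist S T = 0 -> S = T.
Proof.
move=> cS cT; rewrite hausdorff_distE => ST0.
have : maxe (excess S T) (excess T S) <= 0 by rewrite ST0.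
by rewrite ge_max => /andP[? ?]; apply/seteqP; split; exact: excess_le0.
Qed.

Lemma hausdorff_dist_sym S T : hausdorff_dist S T = hausdorff_dist T S.
Proof. by rewrite !hausdorff_distE maxC. Qed.

Lemma hausdorff_dist_triangle T S U : T !=set0 ->
  hausdorff_dist S U <= hausdorff_dist S T + hausdorff_dist T U.
Proof.
move=> T0; rewrite !hausdorff_distE ge_max; apply/andP; split.
  by apply: (le_trans (excess_triangle S U T0)); rewrite leeD// le_max lexx.
apply: (le_trans (excess_triangle U S T0)).
by rewrite addeC leeD// le_max lexx orbT.
Qed.

End hausdorff_dist.

Record closed_hyperspace (M : topologicalType) := ClosedHyperspace {
  hyper_set :> set M ;
  hyper_set_neq0 : hyper_set !=set0 ;
  hyper_set_closed : closed hyper_set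
}.

Arguments hyper_set_closed {M} _.

HB.instance Definition _ (M : topologicalType) :=
  gen_eqMixin (closed_hyperspace M).
HB.instance Definition _ (M : topologicalType) :=
  gen_choiceMixin (closed_hyperspace M).

Section closed_hyperspace_extMetric.
Context {R : realType} {M : extMetricType R}.
Implicit Types S T U : closed_hyperspace M.

Let dist S T : \bar R := hausdorff_dist S T.

Let dist_ge0 S T : 0 <= dist S T.
Proof. exact/hausdorff_dist_ge0/hyper_set_neq0. Qed.

Let distxx S : dist S S = 0.
Proof. exact/hausdorff_distxx/hyper_set_neq0. Qed.

Let dist_positivity S T : dist S T = 0 -> S = T.
Proof.
case: S T => [S S0 cS] [T T0 cT]; rewrite /dist/= => ST0.
have ST := hausdorff_dist_positivity cS cT ST0.
case: T / ST T0 cT {ST0} => T0 cT.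
by congr ClosedHyperspace; exact: Prop_irrelevance.
Qed.

Let dist_sym S T : dist S T = dist T S.
Proof. exact: hausdorff_dist_sym. Qed.

Let dist_triangle T S U : dist S U <= dist S T + dist T U.
Proof. exact/hausdorff_dist_triangle/hyper_set_neq0. Qed.

HB.instance Definition _ := @isExtMetric.Build R (closed_hyperspace M)
  dist dist_ge0 distxx dist_positivity dist_sym dist_triangle.

End closed_hyperspace_extMetric.

(* Main.v *)
Require Import Defs.
From mathcomp Require Import all_boot all_order all_algebra.
From mathcomp Require Import all_classical all_reals ereal topology.

(** A metric version of Cantor's diagonal argument. If [f S] always lay in [S],
    then [f] would fix singletons and identify some pair [{x, y}] with [{x}] or
    [{y}]; so some [f S] has distance at least some real [e > 0] from [S]. Let
    [A] be the closure of the set of all such [f S], for this [e]. If [f A] were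
    within distance less than [e] of such an [f S], then the Hausdorff distance
    of [A] and [S] would be less than [e], and [f S], being in [A], would be
    closer than [e] to [S]. So [f A] has distance at least [e] from [A], whence
    [f A] is in [A], a contradiction. *)

Set Implicit Arguments.
Unset Strict Implicit.
Unset Printing Implicit Defensive.

Import Order.TTheory GRing.Theory Num.Theory.

Local Open Scope classical_set_scope.
Local Open Scope ring_scope.
Local Open Scope ereal_scope.

Section ExtMetricTopology.
Context {R : realType} {M : extMetricType R}.
Implicit Types (x y : M) (S T : set M).

Lemma emdist_gt0 x y : x <> y -> 0 < emdist x y.
Proof.
move=> xy; rewrite lt_def emdist_ge0 andbT; apply/eqP.
by move=> /emdist_positivity.
Qed.

Lemma closed_emdist_ge S x : closed S -> ~ S x ->
  exists2 e : R, (0 < e)%R & forall y, S y -> e%:E <= emdist x y.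
Proof.
move=> cS nSx; have : nbhs x (~` S).
  by apply: open_nbhs_nbhs; split=> //; exact: closed_openC.
move=> /nbhs_ballP[e /= e0 xeS]; exists e => // y Sy.
rewrite leNgt; apply/negP => xye; apply: (xeS y) => //.
by rewrite ballEemdist.
Qed.

(** The strict bound makes [emdist x y] finite, so the ball around [y] of radius [e - emdist x y]
    meets [S] and lies within distance less than [e] of [x]. *)
Lemma closure_emdist_lt S x y (e : R) : closure S y -> emdist x y < e%:E ->
  exists2 z, S z & emdist x z < e%:E.
Proof.
move=> Sy xye.
have xyfin : emdist x y \is a fin_num.
  by rewrite ge0_fin_numE ?emdist_ge0// (lt_le_trans xye)// leey.
have r0 : (0 < e - fine (emdist x y))%R.
  by rewrite subr_gt0 -lte_fin fineK.
have [z [Sz]] := Sy _ (nbhsx_ballx y _ r0).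
rewrite ballEemdist/= EFinB fineK// => yz; exists z => //.
apply: (le_lt_trans (emdist_triangle y x z)).
by rewrite addeC -lteBrDr.
Qed.

Lemma emdist_closed_set1 x : closed [set x].
Proof.
move=> y xy; apply: contrapT => /= yx.
have [e e0 eyx] : exists2 e : R, (0 < e)%R & e%:E <= emdist y x.
  have := emdist_gt0 yx; case: (emdist y x) => [r||]// r0; first by exists r.
  (* At infinite distance any positive real will do. *)
  by exists 1%R; rewrite ?leey.
have yye : emdist y y < e%:E by rewrite emdistxx lte_fin.
by have [z ->] := closure_emdist_lt xy yye; rewrite ltNge eyx.
Qed.

Lemma hausdorff_dist_lt S T x (c : \bar R) : hausdorff_dist S T < c -> S x ->
  exists2 y, T y & emdist x y < c.
Proof.
rewrite /hausdorff_dist gt_max => /andP[STc _] Sx.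
have /ereal_inf_lt[_ [y Ty <-] xyc] :
    ereal_inf [set emdist x y | y in T] < c.
  by apply: le_lt_trans STc; apply: ereal_sup_ubound; exists x.
by exists y.
Qed.

End ExtMetricTopology.

Lemma isometric_embedding_inj {R : realType} {M N : extMetricType R}
  (f : M -> N) : isometric_embedding f -> injective f.
Proof.
move=> f_isom x y fxy; apply: (@emdist_positivity R).
by rewrite -f_isom fxy emdistxx.
Qed.

Lemma isometric_embedding_mem {R : realType} {M : extMetricType R}
    (f : closed_hyperspace M -> M) :
  isometric_embedding f -> forall S, hyper_set S (f S).
Proof.
move=> f_isom S; apply: contrapT.
move=> /(closed_emdist_ge (hyper_set_closed S))[e e0 eS].
(* Russell's condition that [f T] is not in [T], strengthened to a gap [e] common to all [T]: a
   strict bound by [e] passes from the closure back to the image of [far]. *)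
pose far := [set T | forall y, hyper_set T y -> e%:E <= emdist (f T) y].
have cl_neq0 : closure (f @` far) !=set0.
  by exists (f S); apply: subset_closure; exists S.
pose A := ClosedHyperspace cl_neq0 (@closed_closure _ (f @` far)).
have farA : far A.
  move=> y Ay; rewrite leNgt; apply/negP.
  move=> /(closure_emdist_lt Ay)[_ [T farT <-]].
  have AfT : hyper_set A (f T) by apply: subset_closure; exists T.
  (* The point [f T] of [A] gets closer than [e] to some [z] in [T], against [farT]. *)
  rewrite f_isom => AT; have [z Tz] := hausdorff_dist_lt AT AfT.
  by rewrite ltNge farT.
have : e%:E <= emdist (f A) (f A).
  by apply: (farA (f A)); apply: subset_closure; exists A.
by rewrite emdistxx lee_fin leNgt e0.
Qed.

Theorem theorem6p2 (R : realType) (M : extMetricType R)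
    (M_ge2 : exists x y : M, x <> y) :
  ~ exists f : closed_hyperspace M -> M, isometric_embedding f.
Proof.
move=> [f f_isom]; case: M_ge2 => x [y xy].
have set1_neq0 (z : M) : [set z] !=set0 by exists z.
pose single z := ClosedHyperspace (set1_neq0 z) (@emdist_closed_set1 R M z).
have fsingle z : f (single z) = z.
  exact: (isometric_embedding_mem f_isom (single z)).
have xy0 : [set x; y] !=set0 by exists x; left.
pose pair := ClosedHyperspace xy0
  (closedU (@emdist_closed_set1 R M x) (@emdist_closed_set1 R M y)).
(* As [z] is also [f (single z)], injectivity identifies the two closed sets. *)
have pair_single z : f pair = z -> [set x; y] = [set z].
  rewrite -{1}(fsingle z) => /(isometric_embedding_inj f_isom).
  by move=> /(congr1 (@hyper_set M)).
case: (isometric_embedding_mem f_isom pair) => /pair_single xyE.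
  have : [set x; y] y by right.
  by rewrite xyE => yx; apply: xy.
have : [set x; y] x by left.
by rewrite xyE.
Qed.
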